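(* Let $w$ be a finite word in the letters ''.'' (empty box) and ''$1$'' (ball), containing at least one ball. For $M\ge 1$ let $U_n^{t}[M]$ ($n,t\in\mathbb{Z}$) be the solution of the periodic box and ball system (pBBS) of period $L=L_0+M$ whose initial state is $w$ followed by $M$ empty boxes, where $L_0$ is the length of $w$. Let $g$, $S_1\le\dots\le S_g$, $A_i=\sum_{k=1}^g\min[S_i,S_k]$, $\mu={}^t(1,\dots,1)$, $\omega=-{}^t(S_1,\dots,S_g)$ and the vector $c\in\mathbb{R}^g$ be the data (independent of $M$ for large $M$) attached to $w$ as described in the context, so that for all sufficiently large $M$ $$U_n^t[M]=\Theta_n^t+\Theta_{n+1}^{t+1}-\Theta_n^{t+1}-\Theta_{n+1}^t,\qquad \Theta_n^t=\Theta\Bigl(\tfrac{L}{2}\,{}^t(1,\dots,1)+\mu n+\omega t+c;\,B\Bigr),$$ with $B=\bigl((L-2A_i)\delta_{i,j}+2\min[S_i,S_j]\bigr)_{i,j}$. Put $S=\bigl(-2A_i\delta_{i,j}+2\min[S_i,S_j]\bigr)_{i,j}$ and $$T_n^t=\min_{r\in\{0,1\}^g}\Bigl[\tfrac12\langle r,Sr\rangle-\langle r,\mu n+\omega t+c\rangle\Bigr].$$ Then for all $n,t\in\mathbb{Z}$ the limit $\tilde U_n^t:=\lim_{M\to+\infty}U_n^t[M]$ (that is, $L\to+\infty$) exists and $$\tilde U_n^t=T_n^t+T_{n+1}^{t+1}-T_{n+1}^t-T_n^{t+1},$$ and $\tilde U_n^t$ satisfies the box and ball system $$\tilde U_n^{t+1}=\min\Bigl[1-\tilde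 U_n^t,\ \sum_{k=-\infty}^{n-1}\tilde U_k^t-\sum_{k=-\infty}^{n-1}\tilde U_k^{t+1}\Bigr].$$
   Context: **pBBS.** A state of period $L$ is an $L$-periodic sequence $U_n\in\{0,1\}$ ($1$ = ball, $0$ = empty box) with fewer than $L/2$ balls per period. One time step: (round 1) match every ball that is immediately followed (cyclically) by an empty box with that box; (round $j$) ignoring all boxes already matched, match again every remaining ball immediately followed by a remaining empty box; continue until all balls are matched. The new state has balls exactly at the empty boxes that were matched. If $p_j$ is the number of pairs matched in round $j$, the soliton lengths $S_1\le\dots\le S_g$ are the positive integers such that $\#\{i: S_i\ge j\}=p_j$ for all $j\ge1$. For the word $w$, the numbers $g$ and $S_1,\dots,S_g$ are the soliton data of the state ''$w$ followed by $M$ empty boxes'' for $M$ sufficiently large (independent of $M$). Always $L=L_0+M$, and $M$ is taken so large that $L>2A_g$. **Tropical theta function.** For a positive definite real symmetric $g\times g$ matrix $B$, $\Theta(z;B)=\min_{m\in\mathbb{Z}^g}\bigl[\frac12\langle m,Bm\rangle+\langle m,z\rangle\bigr]$, $z\in\mathbb{R}^g$, where $\langle v,w\rangle=\sum_i v_iw_i$. **Matrices.** $K=\bigcup_{d\ge1}\mathbb{C}((q^{1/d}))$ is the Puiseux series field with valuation $\mathrm{val}$ (order in $q$). Put $T(y)=\begin{pmatrix}q&1\\ y&1\end{pmatrix}$, $H(y)=\begin{pmatrix}1&1\\ y&q\end{pmatrix}$. Let $\mathcal{X}(y)$ be the ordered product obtained from $w$ by replacing ''.'' with $H(y)$ and ''1''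 with $T(y)$, let $\mathcal{X}[M]=\mathcal{X}H^M$, and let $a_{i,j}[M](y)$ be the entries of $\mathcal{X}[M]$. **Graph.** $\Gamma[M]$ is the metric graph (the tropical curve of $\det(\mathcal{X}[M](y)-xE)$) consisting of the following pieces, mapped to $\mathbb{R}^2$ (coordinates $(X,Y)$) by $\iota$, with lattice length: $\gamma^+(t)=(\sum_i\min[S_i,t],t)$ and $\gamma^-(t)=(\min[(L-g)t,\,L-\sum_i\min[S_i,t]],t)$ for $0\le t\le S_g$; $\theta_i(t)=(t+A_i,S_i)$ for $0<t<L-2A_i$, $i=1,\dots,g$ (for $i\ne j$ the segments $\theta_i,\theta_j$ are distinct in $\Gamma[M]$ even if $S_i=S_j$), joining $\gamma^+(S_i)$ to $\gamma^-(S_i)$; and half-lines, $t>0$: $\sigma_1(t)=(-Lt,-2t)$, $\sigma_2(t)=(t+L-g,1)$, $\sigma_3(t)=(A_g,t+S_g)$, $\sigma_4(t)=(L-A_g,t+S_g)$. Let $O=(0,0)$. The parameter $t$ on $\gamma^\pm,\theta_i$ is arc length. The cycle $\beta_i$ runs from $O$ along $\gamma^+$ to $\gamma^+(S_i)$, along $\theta_i$ to $\gamma^-(S_i)$, and back along $\gamma^-$ to $O$. For paths $\gamma_1,\gamma_2$, $(\gamma_1,\gamma_2)$ denotes the bilinear pairing given by the signed length of their common part ($+$ for equal, $-$ for opposite directions). **Vector $c$.** Let $Q_i=\theta_i(L/2-A_i)$. On the simply connected set $\Gamma[M]\setminus\{Q_1,\dots,Q_g\}$ define $\boldsymbol{A}_0(P)=((\beta_1,\gamma_P),\dots,(\beta_g,\gamma_P))\in\mathbb{R}^g$,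 where $\gamma_P$ is a path from $O$ to $P$ inside this set; extend additively to formal sums of points. Let $y_1,\dots,y_{\tilde g}$ be the non-zero roots in $K$, with multiplicity, of $a_{2,1}[M](y)$, and $P_k[M]=(\mathrm{val}(a_{1,1}[M](y_k)),\mathrm{val}(y_k))$, regarded as a point of $\Gamma[M]$ (if some $S_i$ coincide, points in the interior of coinciding segments $\theta_i$ are lifted to distinct $\theta_i$, in a way depending only on the coordinates of the points). Then $c:=-\boldsymbol{A}_0(P_1[M]+\dots+P_{\tilde g}[M])$, which is constant for all sufficiently large $M$. The displayed theta-function expression for $U_n^t[M]$ (for a suitable choice of the origin of the box labelling) is the known general solution of the pBBS. *)

(* Defs.v *)
From HB Require Import structures.
From mathcomp Require Import all_boot all_order all_algebra.
From mathcomp Require Import all_classical all_reals all_analysis.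
From mathcomp Require Import complex.
From mathcomp Require Import zify.
Set Implicit Arguments.
Unset Strict Implicit.
Unset Printing Implicit Defensive.
Import Order.TTheory GRing.Theory Num.Theory.
Import numFieldNormedType.Exports.
Local Open Scope classical_set_scope.
Local Open Scope ring_scope.

Section Convolution.
Variable F : fieldType.
Implicit Types a b c : nat -> F.

Definition conv a b (k : nat) : F := \sum_(i < k.+1) a i * b (k - i)%N.

Lemma convE n a b k : (k < n)%N ->
  conv a b k = ((\poly_(i < n) a i) * (\poly_(i < n) b i))`_k.
Proof.
move=> kn; rewrite coefM; apply: eq_bigr => i _.
by rewrite !coef_poly !ifT //; move: (ltn_ord i); lia.
Qed.

Lemma convC a b k : conv a b k = conv b a k.
Proof. by rewrite !(convE _ _ (ltnSn k)) mulrC. Qed.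

Lemma convA a b c k : conv a (conv b c) k = conv (conv a b) c k.
Proof.
have h1 : conv a (conv b c) k = ((\poly_(i < k.+1) a i) *
    ((\poly_(i < k.+1) b i) * (\poly_(i < k.+1) c i)))`_k.
  rewrite coefM; apply: eq_bigr => i _; rewrite coef_poly ltn_ord.
  by rewrite -convE //; lia.
have h2 : conv (conv a b) c k = ((\poly_(i < k.+1) a i) *
    (\poly_(i < k.+1) b i) * (\poly_(i < k.+1) c i))`_k.
  rewrite [RHS]coefM; apply: eq_bigr => i _; rewrite -(convE _ _ (ltn_ord i)).
  by rewrite coef_poly ifT //; lia.
by rewrite h1 h2 mulrA.
Qed.

Lemma convDl a b c k :
  conv (fun i => a i + b i) c k = conv a c k + conv b c k.
Proof. by rewrite -big_split /=; apply: eq_bigr => i _; rewrite mulrDl. Qed.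

Lemma conv1 a k : conv (fun i => (i == 0%N)%:R) a k = a k.
Proof.
rewrite /conv big_ord_recl /= subn0 mul1r big1 ?addr0 // => i _.
by rewrite mul0r.
Qed.

(* the first n coefficients of the inverse of the power series a, a 0 != 0 *)
Fixpoint inv_seq a (n : nat) : seq F :=
  if n is m.+1 then
    let s := inv_seq a m in
    rcons s ((a 0%N)^-1 *
      ((m == 0%N)%:R - \sum_(i < m) a i.+1 * s`_(m - i.+1)))
  else [::].

Definition conv_inv a (n : nat) : F := (inv_seq a n.+1)`_n.

Lemma size_inv_seq a n : size (inv_seq a n) = n.
Proof. by elim: n => //= n IH; rewrite size_rcons IH. Qed.

Lemma nth_inv_seq a n i : (i < n)%N -> (inv_seq a n)`_i = conv_inv a i.
Proof.
elim: n => // n IH; rewrite ltnS leq_eqVlt => /orP[/eqP-> //|i_n].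
by rewrite /= nth_rcons size_inv_seq i_n IH.
Qed.

Lemma conv_invP a k : a 0%N != 0 -> conv a (conv_inv a) k = (k == 0%N)%:R.
Proof.
move=> a0; rewrite /conv big_ord_recl subn0 {1}/conv_inv /= nth_rcons.
rewrite size_inv_seq ltnn eqxx mulVKf // -addrA [X in _ + X](_ : _ = 0) ?addr0 //.
apply/eqP; rewrite addrC subr_eq0; apply/eqP; apply: eq_bigr => i _.
by rewrite nth_inv_seq //; move: (ltn_ord i); lia.
Qed.

End Convolution.

Section Puiseux.
Variable F : fieldType.

(* A Puiseux series is given by its coefficients, indexed by the exponents of
   q in rat; the exponents that occur are bounded below and have a common
   denominator. *)
Definition puiseux_support (f : rat -> F) : Prop :=
  exists (d : nat) (N : int), (0 < d)%N /\
    forall r, f r != 0 -> exists2 k : int, N <= k & r = k%:~R / d%:R.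

Record puiseux := Puiseux {
  pcoef :> rat -> F;
  pcoefP : puiseux_support pcoef }.

HB.instance Definition _ := gen_eqMixin puiseux.
HB.instance Definition _ := gen_choiceMixin puiseux.

Implicit Types f g h : puiseux.

Lemma puiseux_eq f g : pcoef f = pcoef g -> f = g.
Proof.
by case: f g => [f fP] [g gP] /= e; subst g; congr Puiseux; exact: Prop_irrelevance.
Qed.

(* [rep d N a f]: f is the series sum_k a_k q^((N + k) / d) *)
Definition expo (d : nat) (N : int) (k : nat) : rat := (N + k%:Z)%:~R / d%:R.

Lemma expo_inj d N : (0 < d)%N -> injective (expo d N).
Proof.
move=> d0 i j /(congr1 (fun x : rat => x * d%:R)).
rewrite /expo !divfK ?pnatr_eq0 -?lt0n //.
by move=> /intr_inj /addrI [].
Qed.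

Lemma natq_neq0 d : (0 < d)%N -> d%:R != 0 :> rat.
Proof. by rewrite pnatr_eq0 -lt0n. Qed.

Definition rep d N (a : nat -> F) (f : rat -> F) : Prop :=
  [/\ (0 < d)%N, forall k, f (expo d N k) = a k
    & forall r, f r != 0 -> exists k, r = expo d N k].

Lemma rep_support d N a (f : rat -> F) : rep d N a f -> puiseux_support f.
Proof.
case=> d0 _ h; exists d, N; split=> // r /h[k ->].
by exists (N + k%:Z) => //; rewrite lerDl.
Qed.

Lemma repP f : exists d N a, rep d N a f.
Proof.
have [d [N [d0 h]]] := pcoefP f.
exists d, N, (fun k => f (expo d N k)); split=> // r /h[k Nk ->].
exists `|k - N|%N; rewrite /expo; congr (_%:~R / _); lia.
Qed.

Lemma rep_eq d N a b (f g : rat -> F) : rep d N a f -> rep d N b g -> a =1 b -> f = g.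
Proof.
move=> [_ fa fs] [_ gb gs] ab; apply: funext => r.
have [/eqP f0|/fs[k ->]] := boolP (f r == 0); last by rewrite fa gb ab.
have [/eqP g0|/gs[k rk]] := boolP (g r == 0); first by rewrite f0 g0.
by rewrite rk fa gb ab.
Qed.


Lemma rep_refine d N a (f : rat -> F) m : (0 < m)%N -> rep d N a f ->
  exists b, rep (d * m) (N *+ m) b f.
Proof.
move=> m0 [d0 fa fs]; exists (fun k => f (expo (d * m) (N *+ m) k)).
split=> //; first by rewrite muln_gt0 d0.
move=> r /fs[k ->]; exists (k * m)%N; rewrite /expo.
rewrite -[N *+ m]mulr_natr PoszM natz -mulrDl intrM natrM.
by rewrite -pmulrn -mulf_div divff ?mulr1 // pnatr_eq0 -lt0n.
Qed.

Lemma rep_shift d N a (f : rat -> F) m : rep d N a f -> exists b, rep d (N - m%:Z) b f.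
Proof.
move=> [d0 fa fs]; exists (fun k => f (expo d (N - m%:Z) k)); split=> //.
move=> r /fs[k ->]; exists (m + k)%N; rewrite /expo; congr (_%:~R / _); lia.
Qed.

Lemma rep2 f g : exists d N N' a b, rep d N a f /\ rep d N' b g.
Proof.
have [d [N [a ra]]] := repP f; have [e [N' [b rb]]] := repP g.
have [d0 _ _] := ra; have [e0 _ _] := rb.
have [a' ra'] := rep_refine e0 ra; have [b' rb'] := rep_refine d0 rb.
by exists (d * e)%N, (N *+ e), (N' *+ d), a', b'; rewrite {2}mulnC.
Qed.

Lemma rep_add2 d N N' a b (f g : rat -> F) : rep d N a f -> rep d N' b g ->
  exists N'' a' b', rep d N'' a' f /\ rep d N'' b' g.
Proof.
move=> ra rb; have [a' ra'] := rep_shift `|N - Num.min N N'| ra.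
have [b' rb'] := rep_shift `|N' - Num.min N N'| rb.
exists (Num.min N N'), a', b'; split.
  by move: ra'; congr rep; lia.
by move: rb'; congr rep; lia.
Qed.

Lemma rep2' f g : exists d N a b, rep d N a f /\ rep d N b g.
Proof.
have [d [N [N' [a [b [ra rb]]]]]] := rep2 f g.
by have [N'' [a' [b' rab]]] := rep_add2 ra rb; exists d, N'', a', b'.
Qed.

Lemma rep3 f g h : exists d N N' a b c,
  [/\ rep d N a f, rep d N b g & rep d N' c h].
Proof.
have [d [N [a [b [ra rb]]]]] := rep2' f g; have [e [N' [c rc]]] := repP h.
have [d0 _ _] := ra; have [e0 _ _] := rc.
have [a' ra'] := rep_refine e0 ra; have [b' rb'] := rep_refine e0 rb.
have [c' rc'] := rep_refine d0 rc.
by exists (d * e)%N, (N *+ e), (N' *+ d), a', b', c'; rewrite {3}mulnC.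
Qed.

Definition addf (f g : rat -> F) : rat -> F := fun r => f r + g r.
Definition oppf (f : rat -> F) : rat -> F := fun r => - f r.
(* the sum is finite on Puiseux series *)
Definition mulf (f g : rat -> F) : rat -> F :=
  fun r => \sum_(s \in [set: rat]) f s * g (r - s).
Definition monof (c : F) (e : rat) : rat -> F := fun r => if r == e then c else 0.

Lemma rep_add d N a b (f g : rat -> F) : rep d N a f -> rep d N b g ->
  rep d N (fun k => a k + b k) (addf f g).
Proof.
move=> [d0 fa fs] [_ gb gs]; split=> // [k|r]; first by rewrite /addf fa gb.
rewrite /addf; have [->|/fs//] := eqVneq (f r) 0.
by rewrite add0r => /gs.
Qed.

Lemma rep_opp d N a (f : rat -> F) : rep d N a f -> rep d N (fun k => - a k) (oppf f).
Proof.
move=> [d0 fa fs]; split=> // [k|r]; first by rewrite /oppf fa.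
by rewrite oppr_eq0 => /fs.
Qed.

Lemma rep_mono c e : rep `|denq e| (numq e) (fun k => if k == 0%N then c else 0)
  (monof c e).
Proof.
have d0 : (0 < `|denq e|)%N by rewrite absz_gt0 denq_neq0.
have e0 : e = expo `|denq e| (numq e) 0.
  rewrite /expo addr0 -[LHS]divq_num_den; congr (_ / _).
  by rewrite -[denq e in LHS]gez0_abs.
split=> // [k|r]; last by rewrite /monof; case: (eqVneq r e) => [->|_]; [exists 0%N|rewrite eqxx].
by rewrite /monof [X in _ == X]e0 (inj_eq (expo_inj d0)).
Qed.

Lemma expoD d N N' i j : expo d (N + N') (i + j) = expo d N i + expo d N' j.
Proof. by rewrite /expo -mulrDl -intrD; congr (_%:~R / _); lia. Qed.

Lemma rep_mul d N N' a b (f g : rat -> F) : rep d N a f -> rep d N' b g ->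
  rep d (N + N') (conv a b) (mulf f g).
Proof.
move=> [d0 fa fs] [_ gb gs].
have supp r s : f s * g (r - s) != 0 ->
    exists i j, s = expo d N i /\ r = expo d (N + N') (i + j).
  rewrite mulf_eq0 negb_or => /andP[/fs[i si] /gs[j rj]].
  by exists i, j; split=> //; rewrite expoD -si -rj addrC subrK.
split=> // [k|r]; last first.
  apply: contra_neqP => nr; rewrite /mulf fsbig1 // => s _.
  by apply/eqP; apply: contra_notT nr => /supp[i [j [_ ->]]]; exists (i + j)%N.
rewrite /mulf (fsbigE [seq expo d N i | i <- iota 0 k.+1]) //; last 2 first.
- by rewrite map_inj_uniq ?iota_uniq //; exact: expo_inj.
- move=> s _; apply: contraNeq => /supp[i [j [-> /(expo_inj d0) kij]]].
  by apply/mapP; exists i => //; rewrite mem_iota kij; lia.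
under eq_bigl do rewrite in_setT.
rewrite big_map -[iota _ _]/(index_iota 0 k.+1) big_mkord.
apply: eq_bigr => i _; rewrite fa; congr (_ * _).
rewrite -gb; congr (g _); have ik := ltnSE (ltn_ord i).
have := expoD d N N' i (k - i); rewrite subnKC // => ->; by rewrite addrC addKr.
Qed.

Definition padd f g : puiseux.
Proof.
apply: (@Puiseux (addf f g)); have [d [N [a [b [ra rb]]]]] := rep2' f g.
exact: rep_support (rep_add ra rb).
Defined.

Definition popp f : puiseux.
Proof.
apply: (@Puiseux (oppf f)); have [d [N [a ra]]] := repP f.
exact: rep_support (rep_opp ra).
Defined.

Definition pmul f g : puiseux.
Proof.
apply: (@Puiseux (mulf f g)); have [d [N [N' [a [b [ra rb]]]]]] := rep2 f g.
exact: rep_support (rep_mul ra rb).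
Defined.

(* the monomial c q^e *)
Definition pmono (c : F) (e : rat) : puiseux :=
  Puiseux (rep_support (rep_mono c e)).

Lemma paddA : associative padd.
Proof. by move=> f g h; apply/puiseux_eq/funext => r; exact: addrA. Qed.
Lemma paddC : commutative padd.
Proof. by move=> f g; apply/puiseux_eq/funext => r; exact: addrC. Qed.
Lemma padd0 : left_id (pmono 0 0) padd.
Proof.
by move=> f; apply/puiseux_eq/funext => r /=; rewrite /addf /monof if_same add0r.
Qed.
Lemma paddN : left_inverse (pmono 0 0) popp padd.
Proof.
move=> f; apply/puiseux_eq/funext => r /=.
by rewrite /addf /oppf /monof if_same addNr.
Qed.

HB.instance Definition _ := GRing.isZmodule.Build puiseux paddA paddC padd0 paddN.

Lemma pmulA : associative pmul.
Proof.
move=> f g h; have [d [N [N' [a [b [c [ra rb rc]]]]]]] := rep3 f g h.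
have r1 := rep_mul ra (rep_mul rb rc); have r2 := rep_mul (rep_mul ra rb) rc.
rewrite addrA in r1; apply/puiseux_eq/(rep_eq r1 r2); exact: convA.
Qed.

Lemma pmulC : commutative pmul.
Proof.
move=> f g; have [d [N [a [b [ra rb]]]]] := rep2' f g.
exact/puiseux_eq/(rep_eq (rep_mul ra rb) (rep_mul rb ra))/convC.
Qed.

Lemma pmul1 : left_id (pmono 1 0) pmul.
Proof.
move=> f; have [d [N [a ra]]] := repP f; have [d0 _ _] := ra.
have [b rb] := @rep_refine _ _ _ _ d d0 (rep_mono 1 0); rewrite mul0rn mul1n in rb.
have r1 := rep_mul rb ra; rewrite add0r in r1.
apply/puiseux_eq/(rep_eq r1 ra) => k; rewrite -[RHS]conv1.
apply: eq_bigr => i _; congr (_ * _); have [_ <- _] := rb.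
rewrite /= /monof /expo add0r mulf_eq0 invr_eq0 (negPf (natq_neq0 d0)) orbF.
by rewrite intr_eq0; case: (nat_of_ord i).
Qed.

Lemma pmulDl : left_distributive pmul padd.
Proof.
move=> f g h; have [d [N [N' [a [b [c [ra rb rc]]]]]]] := rep3 f g h.
apply/puiseux_eq/(rep_eq (rep_mul (rep_add ra rb) rc)
  (rep_add (rep_mul ra rc) (rep_mul rb rc))) => k; exact: convDl.
Qed.

Lemma pone_neq0 : pmono 1 0 != 0.
Proof.
apply/eqP => /(congr1 (fun f : puiseux => f 0)) /eqP.
by rewrite /= /monof eqxx oner_eq0.
Qed.

HB.instance Definition _ := GRing.Zmodule_isComNzRing.Build puiseux
  pmulA pmulC pmul1 pmulDl pone_neq0.

Lemma rep_ex d N (a : nat -> F) : (0 < d)%N -> exists u, rep d N a u.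
Proof.
move=> d0; pose P r := exists k, r = expo d N k.
exists (fun r => if pselect (P r) is left h then a (projT1 (cid h)) else 0).
split=> // [k|r].
  case: pselect => [h|[]]; last by exists k.
  by case: cid => j /= /(expo_inj d0) ->.
by case: pselect => // _; rewrite eqxx.
Qed.

Lemma pmul_inv f : f != 0 -> exists g, g * f = 1.
Proof.
move=> f0; have [d [N [a ra]]] := repP f; have [d0 fa fs] := ra.
have exa : exists k, a k != 0.
  apply: contrapT => a0; move/eqP: f0; apply; apply/puiseux_eq/funext => r.
  rewrite /= /monof if_same; apply/eqP; apply: contrapT => /negP fr.
  by have [k rk] := fs _ fr; apply: a0; exists k; rewrite -fa -rk.
have [m am mmin] := ex_minnP exa.
have rf : rep d (N + m%:Z) (fun k => a (m + k)%N) f.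
  split=> // [k|r fr]; first by rewrite -fa /expo PoszD addrA.
  have [k rk] := fs _ fr; exists (k - m)%N; rewrite rk /expo -addrA -PoszD subnKC //.
  by apply: mmin; rewrite -fa -rk.
have [u ru] := rep_ex (- (N + m%:Z)) (conv_inv (fun k => a (m + k)%N)) d0.
exists (Puiseux (rep_support ru)).
have r1 := rep_mul ru rf; rewrite addNr in r1.
have [b rb] := rep_refine d0 (rep_mono 1 0); rewrite mul0rn mul1n in rb.
apply/puiseux_eq/(rep_eq r1 rb) => k.
rewrite convC conv_invP ?addn0 //; have [_ <- _] := rb.
rewrite /monof /expo add0r mulf_eq0 invr_eq0 (negPf (natq_neq0 d0)) orbF.
by rewrite intr_eq0; case: k.
Qed.

Definition pinv f : puiseux :=
  if pselect (exists g, g * f = 1) is left h then projT1 (cid h) else 0.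

Lemma pmulV f : f != 0 -> pinv f * f = 1.
Proof.
by rewrite /pinv => /pmul_inv h; case: pselect => // h'; case: cid.
Qed.

Lemma pinv0 : pinv 0 = 0.
Proof.
rewrite /pinv; case: pselect => // h; exfalso; case: h => g.
by move/eqP; rewrite mulr0 eq_sym oner_eq0.
Qed.

HB.instance Definition _ := GRing.ComNzRing_isField.Build puiseux pmulV pinv0.

End Puiseux.

(* A configuration is a map int -> bool, true meaning "ball"; only the boxes
   0, ..., L - 1 of an L-periodic configuration are inspected.  [rest] is the
   list, in cyclic order, of the boxes that have not been matched yet, and
   [next rest x] is the box that cyclically follows x in it. *)

Definition round_balls (u : int -> bool) (rest : seq nat) : seq nat :=
  [seq x <- rest | u x%:Z & ~~ u (next rest x)%:Z].

Definition round_boxes (u : int -> bool) (rest : seq nat) : seq nat :=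
  [seq next rest x | x <- round_balls u rest].

(* boxes still unmatched after j rounds *)
Definition unmatched (u : int -> bool) (L j : nat) : seq nat :=
  iter j (fun rest => [seq x <- rest | x \notin round_balls u rest
                                     & x \notin round_boxes u rest]) (iota 0 L).

(* number of pairs matched in round j, for j >= 1 *)
Definition npairs (u : int -> bool) (L j : nat) : nat :=
  size (round_balls u (unmatched u L j.-1)).

(* Each round matches a pair as long as a ball is left, so that no round of
   rank larger than L matches anything. *)
Definition pbbs_step (L : nat) (u : int -> bool) : int -> bool :=
  fun n => has (fun j => `|(n %% L%:Z)%Z|%N \in round_boxes u (unmatched u L j))
               (iota 0 L).

Definition pbbs_state (L : nat) (u : int -> bool) : Prop :=
  (forall n, u (n + L%:Z) = u n) /\
  (2 * count (fun x : nat => u x%:Z) (iota 0 L) < L)%N.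

(* U n t is the content of the n-th box at time t *)
Definition pbbs_solution (L : nat) (U : int -> int -> bool) : Prop :=
  forall t, pbbs_state L (U^~ t) /\ U^~ (t + 1) = pbbs_step L (U^~ t).

Definition soliton_lengths (L : nat) (u : int -> bool) (S : seq nat) : Prop :=
  [/\ sorted leq S, all (leq 1) S &
      forall j, (0 < j)%N -> count (leq j) S = npairs u L j].

(* the word w (true for a ball) followed by L - size w empty boxes, repeated
   L-periodically *)
Definition word_state (w : seq bool) (L : nat) : int -> bool :=
  fun n => nth false w `|(n %% L%:Z)%Z|%N.

Definition word_solitons (w : seq bool) (S : seq nat) : Prop :=
  \forall M \near \oo,
    soliton_lengths (size w + M) (word_state w (size w + M)) S.

Section Theta.
Variable R : realType.

Definition dotv g (v z : 'cV[R]_g) : R := \sum_(i < g) v i ord0 * z i ord0.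

(* For positive definite B the infimum is attained. *)
Definition trop_theta g (z : 'cV[R]_g) (B : 'M[R]_g) : R :=
  inf (range (fun m : 'cV[int]_g =>
    let m' := map_mx (intr : int -> R) m in
    2^-1 * dotv m' (B *m m') + dotv m' z)).

Variable S : seq nat.
Local Notation g := (size S).

Definition len (i : 'I_g) : nat := nth 0%N S i.
Definition len_max : nat := last 0%N S.
(* A_i is [A_ (len i)], and A_g is [A_ len_max] since S is sorted *)
Definition A_ (s : nat) : nat := \sum_(x <- S) minn s x.

Definition mu : 'cV[R]_g := const_mx 1.
Definition omega : 'cV[R]_g := \col_i - (len i)%:R.

Definition Smx : 'M[R]_g := \matrix_(i, j)
  ((if i == j then - (2 * (A_ (len i))%:R) else 0)
   + 2 * (minn (len i) (len j))%:R).

Definition Bmx (L : nat) : 'M[R]_g := \matrix_(i, j)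
  ((if i == j then L%:R - 2 * (A_ (len i))%:R else 0)
   + 2 * (minn (len i) (len j))%:R).

Definition phase (c : 'cV[R]_g) (n t : int) : 'cV[R]_g :=
  n%:~R *: mu + t%:~R *: omega + c.

Definition theta_nt (L : nat) (c : 'cV[R]_g) (n t : int) : R :=
  trop_theta ((L%:R / 2) *: const_mx 1 + phase c n t) (Bmx L).

(* The default value 0 of the minimum is the value at r = 0. *)
Definition tau_nt (c : 'cV[R]_g) (n t : int) : R :=
  \big[Num.min/0]_(r : {ffun 'I_g -> bool})
    let r' := \col_i (r i)%:R in
    (2^-1 * dotv r' (Smx *m r') - dotv r' (phase c n t)).

End Theta.

Inductive edge (g : nat) :=
  | GammaP | GammaM | ThetaE of 'I_g | Sigma1 | Sigma2 | Sigma3 | Sigma4.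
Arguments GammaP {g}.
Arguments GammaM {g}.
Arguments Sigma1 {g}.
Arguments Sigma2 {g}.
Arguments Sigma3 {g}.
Arguments Sigma4 {g}.

HB.instance Definition _ g := gen_eqMixin (edge g).

Section Graph.
Variables (R : realType) (S : seq nat) (L : nat).
Local Notation g := (size S).

(* the point with parameter x.2 of the edge x.1 *)
Definition gpoint : Type := edge g * R.

Definition min_sum (t : R) : R := \sum_(x <- S) Num.min x%:R t.

Definition theta_length (i : 'I_g) : R := L%:R - 2 * (A_ S (len i))%:R.

Definition gcoord (x : gpoint) : R * R :=
  let t := x.2 in
  match x.1 with
  | GammaP => (min_sum t, t)
  | GammaM => (Num.min ((L%:R - g%:R) * t) (L%:R - min_sum t), t)
  | ThetaE i => (t + (A_ S (len i))%:R, (len i)%:R)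
  | Sigma1 => (- (L%:R * t), - (2 * t))
  | Sigma2 => (t + L%:R - g%:R, 1)
  | Sigma3 => ((A_ S (len_max S))%:R, t + (len_max S)%:R)
  | Sigma4 => (L%:R - (A_ S (len_max S))%:R, t + (len_max S)%:R)
  end.

Definition on_graph (x : gpoint) : Prop :=
  let t := x.2 in
  match x.1 with
  | GammaP | GammaM => 0 <= t <= (len_max S)%:R
  | ThetaE i => 0 < t < theta_length i
  | Sigma1 | Sigma2 | Sigma3 | Sigma4 => 0 < t
  end.

(* the same, with the end points of the edges theta_i and sigma_k added *)
Definition on_closed_edge (x : gpoint) : Prop :=
  let t := x.2 in
  match x.1 with
  | GammaP | GammaM => 0 <= t <= (len_max S)%:R
  | ThetaE i => 0 <= t <= theta_length i
  | Sigma1 | Sigma2 | Sigma3 | Sigma4 => 0 <= t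
  end.

Definition origin : gpoint := (GammaP, 0).

(* Canonical representative of a point of the closed edges: this encodes how
   the edges are glued together. *)
Definition glue (x : gpoint) : gpoint :=
  let t := x.2 in
  match x.1 with
  | GammaP => x
  | GammaM => if t == 0 then origin else x
  | ThetaE i => if t == 0 then (GammaP, (len i)%:R) else
                if t == theta_length i then (GammaM, (len i)%:R) else x
  | Sigma1 => if t == 0 then origin else x
  | Sigma2 => if t == 0 then (GammaM, 1) else x
  | Sigma3 => if t == 0 then (GammaP, (len_max S)%:R) else x
  | Sigma4 => if t == 0 then (GammaM, (len_max S)%:R) else x
  end.

(* [(e, (a, b))] runs along e from the parameter a to the parameter b *)
Definition segment : Type := edge g * (R * R).

Fixpoint is_path (x : gpoint) (p : seq segment) (y : gpoint) : Prop :=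
  match p with
  | [::] => glue x = glue y
  | (e, (a, b)) :: p' =>
      [/\ on_closed_edge (e, a), on_closed_edge (e, b), glue x = glue (e, a)
        & is_path (e, b) p' y]
  end.

(* signed length of the common part *)
Definition segment_pairing (s s' : segment) : R :=
  let: (e, (a, b)) := s in
  let: (e', (a', b')) := s' in
  if e == e' then
    Num.sg (b - a) * Num.sg (b' - a') *
    Num.max 0 (Num.min (Num.max a b) (Num.max a' b')
               - Num.max (Num.min a b) (Num.min a' b'))
  else 0.

Definition path_pairing (p p' : seq segment) : R :=
  \sum_(s <- p) \sum_(s' <- p') segment_pairing s s'.

Definition beta (i : 'I_g) : seq segment :=
  [:: (GammaP, (0, (len i)%:R)); (ThetaE i, (0, theta_length i));
      (GammaM, ((len i)%:R, 0))].

(* Q_i has parameter L/2 - A_i on theta_i *)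
Definition avoids_Q (p : seq segment) : Prop :=
  forall i a b, (ThetaE i, (a, b)) \in p ->
    ~~ (Num.min a b <= L%:R / 2 - (A_ S (len i))%:R <= Num.max a b).

(* v = A_0(x); since Gamma[M] \ {Q_1, ..., Q_g} is simply connected, v does
   not depend on the path *)
Definition is_A0 (x : gpoint) (v : 'cV[R]_g) : Prop :=
  exists p, [/\ is_path origin p x, avoids_Q p
              & v = \col_i path_pairing (beta i) p].

(* The points Q k of the graph lift the points P k of the plane; lifts to
   the interior of coinciding segments theta_i lie on distinct theta_i. *)
Definition is_lift n (P : 'I_n -> R * R) (Q : 'I_n -> gpoint) : Prop :=
  (forall k, on_graph (Q k) /\ gcoord (Q k) = P k) /\
  (forall k l i j t t', k != l -> Q k = (ThetaE i, t) -> Q l = (ThetaE j, t') ->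
     len i = len j -> (exists2 i', i' != i & len i' = len i) -> i != j).

End Graph.

Section VectorC.
Variable R : realType.
Local Notation K := (puiseux R[i]).

(* order in q; the valuation of 0 is +oo *)
Definition val_q (f : K) : \bar R :=
  ereal_inf [set (ratr r : R)%:E | r in [set r | f r != 0]].

Definition qK : K := pmono (1 : R[i]) 1.

Definition mx22 (a b c d : {poly K}) : 'M[{poly K}]_2 :=
  \matrix_(i, j) if i == ord0 then (if j == ord0 then a else b)
                 else (if j == ord0 then c else d).

Definition Tmx : 'M[{poly K}]_2 := mx22 qK%:P 1 'X 1.
Definition Hmx : 'M[{poly K}]_2 := mx22 1 1 'X qK%:P.

Definition Xmx (w : seq bool) (M : nat) : 'M[{poly K}]_2 :=
  (\prod_(b <- w) (if b then Tmx else Hmx)) * Hmx ^+ M.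

Definition nonzero_roots n (p : {poly K}) (y : 'I_n -> K) : Prop :=
  (forall k, y k != 0) /\
  exists (a : K) (e : nat),
    a != 0 /\ p = a *: ('X^e * \prod_(k < n) ('X - (y k)%:P)).

(* [lift] is the rule, depending only on the coordinates of the points,
   according to which the points P_k[M] are regarded as points of Gamma[M] *)
Definition is_vector_c (w : seq bool) (S : seq nat)
    (lift : forall n, ('I_n -> R * R) -> 'I_n -> gpoint R S)
    (M : nat) (c : 'cV[R]_(size S)) : Prop :=
  let L := (size w + M)%N in
  let a11 := Xmx w M 0 0 in
  let a21 := Xmx w M 1 0 in
  exists (n : nat) (y : 'I_n -> K) (P : 'I_n -> R * R)
         (v : 'I_n -> 'cV[R]_(size S)),
    [/\ nonzero_roots a21 y,
        forall k, val_q a11.[y k] = (P k).1%:E /\ val_q (y k) = (P k).2%:E,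
        is_lift L P (lift n P),
        forall k, is_A0 L (lift n P k) (v k)
      & c = - \sum_(k < n) v k].

End VectorC.

(* Main.v *)
Require Import Defs.
From HB Require Import structures.
From mathcomp Require Import all_boot all_order all_algebra.
From mathcomp Require Import all_classical all_reals all_analysis.
From mathcomp Require Import zify ring lra.

(** Since [Bmx] is [Smx] plus [L] times the identity, the term of index [m] of
    the theta function contains [L / 2] times the sum of the [m_i ^ 2 + m_i].
    For large [L] the minimum is therefore attained with all [m_i] in
    [{-1, 0}], where this sum vanishes, so that [theta_nt] is equal to [tau_nt]
    for all large [L] ([is_theta_min_tau]).  Each box of the periodic automaton
    is then eventually constant in [M], with the announced limit.

    For the limit automaton, write the limit state as
    [tau_mass t (n + 1) - tau_mass t n], where [tau_mass t n] is
    [tau_nt c n (t + 1) - tau_nt c n t].  As the minimum of 0 and finitely many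
    affine functions of [n] with negative slopes, [tau_nt] is zero far to the
    left and affine far to the right, so [tau_mass t] goes from 0 to the total
    length of the solitons ([tau_mass_left], [tau_mass_right]).  Hence the
    series in the statement converge to [tau_mass].

    It remains to see the rule of the automaton.  A step of the periodic
    automaton is described by a carrier: if [E n] is the number of arcs from a
    matched ball to its box that pass over the gap before box [n], then
    [E (n + 1) - E n] is the difference of the contents of box [n] before and
    after the step, and box [n] receives a ball exactly when it was empty and
    [0 < E n] ([pbbs_carrier]).  This uses that every ball is matched, which
    follows from the conservation of the number of balls; that number is
    obtained from the theta functions, whose quasi-periodicity makes the sum
    over a period equal to the total length of the solitons ([near_mass]).  Far
    to the right of the limit state the carrier is empty.  Counting back from
    there, [E n] is [tau_mass t n - tau_mass (t + 1) n] for large [M], which is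
    the difference of the two series. *)

Set Implicit Arguments.
Unset Strict Implicit.
Unset Printing Implicit Defensive.
Import Order.TTheory GRing.Theory Num.Theory.
Import numFieldNormedType.Exports.
Local Open Scope classical_set_scope.
Local Open Scope ring_scope.

(** * The carrier of the periodic automaton *)

Section Carrier.
Local Open Scope nat_scope.

(** The last site of [s] before [n], cyclically: for an increasing [s] and any
    position [n], the only site of [s] whose arc to its successor in [s] can
    pass over the gap to the left of [n]. *)
Definition cyc_pred (s : seq nat) (n : nat) : nat :=
  last (last 0 s) [seq x <- s | x < n].

Lemma next_cyc_pred s n : sorted ltn s -> n \in s -> next s (cyc_pred s n) = n.
Proof.
move=> sS /splitPr sn; case: sn sS => s1 s2 sS.
have us : uniq (s1 ++ n :: s2) by apply: sorted_uniq sS => //; [exact: ltn_trans|exact: ltnn].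
have lt_s1 : {in s1, forall x, x < n}.
  move: sS; rewrite sorted_pairwise; last exact: ltn_trans.
  rewrite pairwise_cat => /and3P[/allrelP h _ _] x xs1.
  by apply: h; rewrite // mem_head.
have gt_s2 : {in s2, forall x, n < x}.
  move: sS; rewrite sorted_pairwise; last exact: ltn_trans.
  by rewrite pairwise_cat /= => /and3P[_ _ /andP[/allP]].
have -> : cyc_pred (s1 ++ n :: s2) n = last n (s2 ++ s1).
  rewrite /cyc_pred filter_cat /= ltnn.
  rewrite (_ : [seq x <- s1 | x < n] = s1); last first.
    by apply/all_filterP/allP.
  rewrite (_ : [seq x <- s2 | x < n] = [::]); last first.
    apply/eqP; rewrite -[_ == _]negbK -has_filter; apply/hasPn => x /gt_s2.
    by rewrite -leqNgt; exact: ltnW.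
  by rewrite cats0 !last_cat.
have us' : uniq (n :: s2 ++ s1) by rewrite -cat_cons -(rot_size_cat s1) rot_uniq.
rewrite -(next_rot (size s1) us) rot_size_cat cat_cons next_nth mem_last.
by rewrite index_last // nth_default.
Qed.

Lemma cyc_predS s n : sorted ltn s ->
  cyc_pred s n.+1 = if n \in s then n else cyc_pred s n.
Proof.
move=> sS; rewrite /cyc_pred; have [/splitPr sn|ns] := boolP (n \in s); last first.
  congr last; apply: eq_in_filter => x xs; rewrite ltnS leq_eqVlt.
  by case: eqVneq => // xn; rewrite -xn xs in ns.
case: sn sS => s1 s2; rewrite sorted_pairwise; last exact: ltn_trans.
rewrite pairwise_cat /= => /and3P[_ _ /andP[/allP gt_s2 _]].
rewrite filter_cat /= ltnSn (_ : [seq x <- s2 | x < n.+1] = [::]) ?last_cat //.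
apply/eqP; rewrite -[_ == _]negbK -has_filter; apply/hasPn => x /gt_s2.
by rewrite -leqNgt.
Qed.

Variables (u : int -> bool) (L : nat).

Definition matched_balls (j x : nat) : bool :=
  has (fun i => x \in round_balls u (unmatched u L i)) (iota 0 j).

Definition matched_boxes (j x : nat) : bool :=
  has (fun i => x \in round_boxes u (unmatched u L i)) (iota 0 j).

Lemma matched_ballsS j x : matched_balls j.+1 x =
  matched_balls j x || (x \in round_balls u (unmatched u L j)).
Proof. by rewrite /matched_balls -addn1 iotaD has_cat /= orbF. Qed.

Lemma matched_boxesS j x : matched_boxes j.+1 x =
  matched_boxes j x || (x \in round_boxes u (unmatched u L j)).
Proof. by rewrite /matched_boxes -addn1 iotaD has_cat /= orbF. Qed.

Lemma unmatchedS j : unmatched u L j.+1 =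
  [seq x <- unmatched u L j | x \notin round_balls u (unmatched u L j)
                            & x \notin round_boxes u (unmatched u L j)].
Proof. by []. Qed.

Lemma unmatched_sorted j : sorted ltn (unmatched u L j).
Proof.
elim: j => [|j IH]; first exact: iota_ltn_sorted.
by rewrite unmatchedS sorted_filter //; exact: ltn_trans.
Qed.

Lemma mem_unmatched j x : (x \in unmatched u L j) =
  [&& x < L, ~~ matched_balls j x & ~~ matched_boxes j x].
Proof.
elim: j => [|j IH]; first by rewrite mem_iota add0n /= !andbT.
rewrite unmatchedS mem_filter IH matched_ballsS matched_boxesS !negb_or.
by rewrite -!andbA; case: (x \notin _); case: (x \notin _); rewrite /= ?andbF ?andbT.
Qed.

Lemma round_balls_sub s x : x \in round_balls u s -> x \in s /\ u x%:Z.
Proof. by rewrite mem_filter => /andP[/andP[]]. Qed.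

Lemma round_boxes_sub s y : y \in round_boxes u s -> y \in s /\ ~~ u y%:Z.
Proof.
case/mapP => x; rewrite mem_filter => /andP[/andP[_ unx] xs] ->.
by rewrite mem_next.
Qed.

Lemma mem_round_boxes s n : sorted ltn s -> n \in s ->
  (n \in round_boxes u s) = (cyc_pred s n \in round_balls u s).
Proof.
move=> sS ns; have us : uniq s.
  by apply: sorted_uniq sS => //; [exact: ltn_trans|exact: ltnn].
have nE := next_cyc_pred sS ns.
apply/mapP/idP => [[x xb nx]|pb]; last by exists (cyc_pred s n).
by rewrite -(prev_next us (cyc_pred s n)) nE nx prev_next.
Qed.

Lemma cyc_pred_end s : {in s, forall x, x < L} -> cyc_pred s L = cyc_pred s 0.
Proof.
move=> sL; rewrite /cyc_pred (_ : [seq x <- s | x < 0] = [::]); last by elim: s {sL}.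
by rewrite (all_filterP _) /=; [case: s {sL}|apply/allP].
Qed.

(** [E n] counts the arcs, drawn rightwards from each matched ball to its box
    in the first [j] rounds, that pass over the gap to the left of box [n].  It
    vanishes at an unmatched site because a ball is matched with the next
    unmatched site, so that no arc jumps over a site that is still unmatched.
    The arcs of a single round are disjoint, so one more round adds 0 or 1:
    the arc starting at [cyc_pred s n] is the only one that may pass there. *)
Lemma round_carrier j : exists E : nat -> nat,
  [/\ E L = E 0,
      forall n, n < L -> E n.+1 + matched_boxes j n = E n + matched_balls j n
    & {in unmatched u L j, forall n, E n = 0}].
Proof.
elim: j => [|j [E [EL ES E0]]]; first by exists (fun=> 0).
set s := unmatched u L j in E0 *; have sS : sorted ltn s := unmatched_sorted j.
have sL : {in s, forall x, x < L} by move=> x; rewrite mem_unmatched => /and3P[].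
exists (fun n => E n + (cyc_pred s n \in round_balls u s)); split=> [|n nL|n].
- by rewrite EL cyc_pred_end.
- have := ES n nL; rewrite matched_ballsS matched_boxesS -/s cyc_predS //.
  have [ns|ns] := boolP (n \in s).
    have := ns; rewrite mem_unmatched => /and3P[_ /negPf-> /negPf->].
    rewrite mem_round_boxes //=; lia.
  have /negPf-> : n \notin round_balls u s by apply: contra ns => /round_balls_sub[].
  have /negPf-> : n \notin round_boxes u s by apply: contra ns => /round_boxes_sub[].
  rewrite !orbF; lia.
rewrite unmatchedS -/s mem_filter => /andP[/andP[_ nb] ns].
by rewrite E0 // -mem_round_boxes // (negPf nb).
Qed.

Lemma matched_ballsW j x : matched_balls j x -> u x%:Z.
Proof. by case/hasP => i _ /round_balls_sub[]. Qed.

Lemma matched_boxesW j x : matched_boxes j x -> ~~ u x%:Z.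
Proof. by case/hasP => i _ /round_boxes_sub[]. Qed.

Lemma sum_pbbs_step : \sum_(n < L) pbbs_step L u n%:Z =
   \sum_(n < L) matched_boxes L n.
Proof.
apply: eq_bigr => n _; rewrite /pbbs_step /matched_boxes.
by rewrite modz_nat absz_nat modn_small.
Qed.

End Carrier.

(** The carrier of the automaton: it walks from left to right, picks up every
    ball it meets and drops one in every empty box as long as it holds one.
    The conservation of the number of balls is a hypothesis, from which it
    follows that the rounds performed by [pbbs_step] match every ball: the
    matched boxes are as many as the matched balls because the load [E] is
    periodic. *)
Lemma pbbs_carrier (L : nat) (u : int -> bool) :
  (0 < L)%N -> (forall n, u (n + L%:Z) = u n) ->
  (\sum_(n < L) pbbs_step L u n%:Z = \sum_(n < L) u n%:Z)%N ->
  exists E : int -> nat, forall n : int,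
    (E (n + 1)%R + pbbs_step L u n = E n + u n)%N /\
    pbbs_step L u n = ~~ u n && (0 < E n)%N.
Proof.
move=> L0 uL mass; have [E [EL ES E0]] := round_carrier u L L.
rewrite sum_pbbs_step in mass.
have sumS (F : nat -> nat) k : (\sum_(n < k) F n.+1 + F 0 = \sum_(n < k) F n + F k)%N.
  elim: k => [|k IH]; first by rewrite !big_ord0.
  by rewrite big_ord_recr [in RHS]big_ord_recr /= addnAC IH.
have balls_boxes : (\sum_(n < L) matched_boxes u L L n =
    \sum_(n < L) matched_balls u L L n)%N.
  have : (\sum_(n < L) (E n.+1 + matched_boxes u L L n) =
          \sum_(n < L) (E n + matched_balls u L L n))%N.
    by apply: eq_bigr => n _; exact: ES.
  by rewrite !big_split /=; move: (sumS E L); rewrite EL => /addIn -> /addnI.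
have all_matched n : (n < L)%N -> u n%:Z = matched_balls u L L n.
  move=> nL; have le_u (i : 'I_L) : true -> (matched_balls u L L i <= u i%:Z)%N.
    by move=> _; case: (boolP (matched_balls _ _ _ _)) => // /matched_ballsW->.
  have := leqif_sum (fun i (_ : true) => leqif_eq (le_u i isT)).
  rewrite -balls_boxes -mass => /leqif_refl/forallP/(_ (Ordinal nL))/=/eqP.
  by case: (u n) => //; case: (matched_balls u L L n).
exists (fun n => E `|(n %% L%:Z)%Z|%N) => n.
have [k kL nk] : exists2 k : nat, (k < L)%N & (n %% L%:Z)%Z = k%:Z.
  by exists `|(n %% L%:Z)%Z|%N; lia.
have u_k : u n = u k%:Z.
  have uLz (z : nat) m : u (m + z%:Z * L%:Z) = u m.
    elim: z m => [|z IH] m; first by rewrite mul0r addr0.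
    by rewrite -[in RHS]IH -[in RHS]uL; congr u; lia.
  rewrite (divz_eq n L%:Z) nk; case: (n %/ L%:Z)%Z => z; first by rewrite addrC uLz.
  by rewrite -[LHS](uLz z.+1); congr u; lia.
have v_k : pbbs_step L u n = matched_boxes u L L k by rewrite /pbbs_step nk.
have E_k : E `|((n + 1) %% L%:Z)%Z|%N = E k.+1.
  have [kL'|kL'] : (k.+1 < L)%N \/ k.+1 = L by lia.
    by congr E; rewrite -modzDml nk modz_small /=; lia.
  by rewrite -modzDml nk (_ : k%:Z + 1 = L%:Z) ?modzz /= ?kL' ?EL //; lia.
rewrite E_k v_k u_k nk absz_nat; have Ek := ES _ kL; rewrite -all_matched // in Ek.
(* A box that receives a ball is the end of an arc, which passes over the gap
   before it; an empty box that receives none is unmatched. *)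
split=> //; have [vk|vk] := boolP (matched_boxes u L L k).
  by move: Ek; rewrite vk; have /negPf-> := matched_boxesW vk; rewrite /=; lia.
have [//|uk /=] := boolP (u k%:Z).
by rewrite E0 // mem_unmatched kL vk -all_matched // uk.
Qed.

(** * The theta function for a large period *)

Section Dot.
Variables (R : realType) (g : nat).
Implicit Types (v w z : 'cV[R]_g) (B : 'M[R]_g).

Lemma dotvC v w : dotv v w = dotv w v.
Proof. by apply: eq_bigr => i _; rewrite mulrC. Qed.

Lemma dotvDr v w z : dotv v (w + z) = dotv v w + dotv v z.
Proof. by rewrite -big_split; apply: eq_bigr => i _; rewrite mxE mulrDr. Qed.

Lemma dotvDl v w z : dotv (v + w) z = dotv v z + dotv w z.
Proof. by rewrite dotvC dotvDr !(dotvC z). Qed.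

Lemma dotvZr a v w : dotv v (a *: w) = a * dotv v w.
Proof. by rewrite mulr_sumr; apply: eq_bigr => i _; rewrite mxE mulrCA. Qed.

Lemma dotvNr v w : dotv v (- w) = - dotv v w.
Proof. by rewrite -scaleN1r dotvZr mulN1r. Qed.

Lemma dotvNl v w : dotv (- v) w = - dotv v w.
Proof. by rewrite dotvC dotvNr dotvC. Qed.

Lemma dotv_sym B v w : B^T = B -> dotv v (B *m w) = dotv w (B *m v).
Proof.
move=> Bsym; rewrite /dotv; under eq_bigr do rewrite mxE mulr_sumr.
rewrite exchange_big; apply: eq_bigr => j _ /=; rewrite mxE mulr_sumr.
apply: eq_bigr => i _; have -> : B i j = B j i by rewrite -[in LHS]Bsym mxE.
by ring.
Qed.

Definition theta_term B z (v : 'cV[R]_g) : R := 2^-1 * dotv v (B *m v) + dotv v z.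

Definition intv (m : 'cV[int]_g) : 'cV[R]_g := map_mx (intr : int -> R) m.

(** [trop_theta] is an infimum, which is 0 by convention when the terms are not
    bounded below; asking that the minimum be attained excludes this. *)
Definition is_theta_min B z (x : R) : Prop :=
  (forall m, x <= theta_term B z (intv m)) /\
  exists m, theta_term B z (intv m) = x.

Lemma trop_thetaE B z x : is_theta_min B z x -> trop_theta z B = x.
Proof.
move=> [lbx [m0 fx]]; apply/eqP; rewrite eq_le; apply/andP; split.
  rewrite -fx; apply: ge_inf; last by exists m0.
  by exists x => _ [m _ <-]; exact: lbx.
apply: lb_le_inf; first by exists x; exists m0.
by move=> _ [m _ <-]; exact: lbx.
Qed.

(** Quasi-periodicity: translating the summation index by [e] is completing the
    square, since [B] is symmetric. *)
Lemma is_theta_minD B z x (e : 'cV[int]_g) : B^T = B -> is_theta_min B z x ->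
  is_theta_min B (z + B *m intv e)
    (x - (dotv (intv e) z + 2^-1 * dotv (intv e) (B *m intv e))).
Proof.
move=> Bsym [lbx [m0 fx]].
have shift m : theta_term B (z + B *m intv e) (intv m) =
    theta_term B z (intv (m + e))
    - (dotv (intv e) z + 2^-1 * dotv (intv e) (B *m intv e)).
  rewrite /theta_term /intv map_mxD -!/(intv _) mulmxDr !(dotvDl, dotvDr).
  rewrite (dotv_sym (intv e) (intv m) Bsym); lra.
split=> [m|]; first by rewrite shift lerB.
by exists (m0 - e); rewrite shift subrK fx.
Qed.

(** On integer vectors, the linear part is also bounded by the sum of squares,
    since [`|k| <= k ^ 2] for an integer [k]. *)
Lemma theta_term_bound B z : exists2 K : R, 0 <= K &
  forall m, `|theta_term B z (intv m)| <= K * dotv (intv m) (intv m).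
Proof.
exists (\sum_i (\sum_j `|B i j| + `|z i ord0|)).
  by apply: sumr_ge0 => i _; rewrite addr_ge0 // sumr_ge0.
move=> m; set v := intv m; set N := dotv v v.
have sqN i : v i ord0 ^+ 2 <= N.
  rewrite /N /dotv (bigD1 i) //= -expr2 lerDl sumr_ge0 // => j _.
  by rewrite -expr2 sqr_ge0.
have absN i : `|v i ord0| <= N.
  apply: le_trans (sqN i); rewrite -real_normK ?num_real // mxE -intr_norm.
  rewrite expr2 -intrM ler_int; nia.
have mulN i j : `|v i ord0| * `|v j ord0| <= N.
  have sqnN k : `|v k ord0| ^+ 2 <= N by rewrite real_normK ?num_real.
  have hi := sqnN i; have hj := sqnN j.
  move: hi hj (sqr_ge0 (`|v i ord0| - `|v j ord0|)); rewrite sqrrB -mulr_natl.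
  by lra.
have N0 : 0 <= N by rewrite /N /dotv sumr_ge0 // => i _; rewrite -expr2 sqr_ge0.
have hB : `|dotv v (B *m v)| <= \sum_i \sum_j `|B i j| * N.
  apply: le_trans (ler_norm_sum _ _ _) _; apply: ler_sum => i _.
  rewrite [(B *m v) i _]mxE mulr_sumr; apply: le_trans (ler_norm_sum _ _ _) _.
  by apply: ler_sum => j _; rewrite mulrCA !normrM ler_wpM2l.
have hz : `|dotv v z| <= \sum_i `|z i ord0| * N.
  apply: le_trans (ler_norm_sum _ _ _) _; apply: ler_sum => i _.
  by rewrite normrM mulrC ler_wpM2l.
rewrite mulr_suml; under eq_bigr do rewrite mulrDl mulr_suml.
rewrite big_split /=; apply: le_trans (ler_normD _ _) _; apply: lerD => //.
rewrite normrM gtr0_norm ?invr_gt0 ?ltr0n //; move: (normr_ge0 (dotv v (B *m v))); lra.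
Qed.

End Dot.

Section ThetaLimit.
Variables (R : realType) (S : seq nat).
Local Notation g := (size S).
Implicit Types (c : 'cV[R]_g).

Definition chi (r : {ffun 'I_g -> bool}) : 'cV[R]_g := \col_i (r i)%:R.

Definition tau_term c n t (r : {ffun 'I_g -> bool}) : R :=
  2^-1 * dotv (chi r) (Smx R S *m chi r) - dotv (chi r) (phase c n t).

Lemma tau_term0 c n t : tau_term c n t [ffun=> false] = 0.
Proof.
rewrite /tau_term (_ : chi _ = 0); last by apply/colP => i; rewrite !mxE ffunE.
by rewrite mulmx0 /dotv !big1 ?mulr0 ?subrr // => i _; rewrite !mxE mul0r.
Qed.

Lemma tau_nt_le c n t r : tau_nt c n t <= tau_term c n t r.
Proof. exact: (bigmin_le _ _ (tau_term c n t)). Qed.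

Lemma tau_nt_attained c n t : exists r, tau_nt c n t = tau_term c n t r.
Proof.
apply: (big_ind (fun x => exists r, x = tau_term c n t r))
    => [|x y [r ->] [r' ->]|r _]; last by exists r.
  by exists [ffun=> false]; rewrite tau_term0.
by rewrite minEle; case: ifP => _; [exists r|exists r'].
Qed.

Lemma tau_nt_eq c n t r : (forall r', tau_term c n t r <= tau_term c n t r') ->
  tau_nt c n t = tau_term c n t r.
Proof.
move=> rmin; apply/eqP; rewrite eq_le tau_nt_le /=.
by have [r' ->] := tau_nt_attained c n t.
Qed.

Lemma BmxE L : Bmx R S L = L%:R%:M + Smx R S.
Proof.
apply/matrixP => i j; rewrite !mxE; case: eqP => _; rewrite ?mulr0n ?add0r //.
by rewrite mulr1n addrA.
Qed.

Lemma Bmx_sym L : (Bmx R S L)^T = Bmx R S L.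
Proof.
apply/matrixP => i j; rewrite !mxE eq_sym minnC.
by case: eqP => // ->.
Qed.

Lemma theta_termE L z v : theta_term (Bmx R S L) ((L%:R / 2) *: const_mx 1 + z) v =
  L%:R / 2 * (dotv v v + dotv v (const_mx 1)) + theta_term (Smx R S) z v.
Proof.
rewrite /theta_term BmxE mulmxDl mul_scalar_mx !dotvDr !dotvZr; lra.
Qed.

Lemma theta_term_chi c n t r :
  theta_term (Smx R S) (phase c n t) (- chi r) = tau_term c n t r.
Proof. by rewrite /theta_term mulmxN dotvNr !dotvNl opprK. Qed.

(** By [theta_termE], the dependence on [L] of the term of index [m] is
    [L / 2] times the sum of the [m_i ^ 2 + m_i].  This sum is zero when all
    the [m_i] are 0 or -1, which gives the terms of [tau_nt].  Otherwise it is
    at least 1 and dominates the sum of squares of [m], hence, for large [L],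
    the rest of the term, which is then not below the term of index 0. *)
Lemma is_theta_min_tau c n t : \forall M \near \oo, forall L, (M <= L)%N ->
  is_theta_min (Bmx R S L) ((L%:R / 2) *: const_mx 1 + phase c n t) (tau_nt c n t).
Proof.
have [K K0 hK] := theta_term_bound (Smx R S) (phase c n t).
near=> M => L ML; split=> [m|]; last first.
  have [r ->] := tau_nt_attained c n t; exists (\col_i - (r i)%:R).
  have -> : intv R (\col_i - (r i)%:R) = - chi r.
    by apply/colP => i; rewrite !mxE rmorphN rmorph_nat.
  rewrite theta_termE theta_term_chi [X in _ * X](_ : _ = 0) ?mulr0 ?add0r //.
  rewrite /dotv -big_split big1 // => i _; rewrite !mxE; case: (r i) => /=; lra.
rewrite theta_termE; set v := intv R m; set D := _ + dotv v _.
have DE : D = (\sum_i (m i ord0 ^+ 2 + m i ord0))%:~R.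
  rewrite rmorph_sum /D /dotv -big_split /=; apply: eq_bigr => i _.
  by rewrite !mxE mulr1 rmorphD rmorphXn.
have [m01|] := boolP [forall i, (m i ord0 == 0) || (m i ord0 == -1)].
  pose r : {ffun 'I_g -> bool} := [ffun i => m i ord0 == -1].
  have -> : v = - chi r.
    apply/colP => i; rewrite !mxE ffunE.
    by have /orP[/eqP->|/eqP->] := forallP m01 i; rewrite ?oppr0 //= ?rmorphN.
  rewrite theta_term_chi; apply: le_trans (tau_nt_le c n t r) _.
  rewrite lerDr mulr_ge0 ?divr_ge0 // DE ler0z sumr_ge0 // => i _; nia.
rewrite negb_forall => /existsP[i0]; rewrite negb_or => /andP[mi0 mi1].
have D1 : 1 <= D.
  rewrite DE -[1]/(1%:~R) ler_int (bigD1 i0) //= ler_wpDr //; last nia.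
  by apply: sumr_ge0 => i _; nia.
(* from [k ^ 2 <= 2 * (k ^ 2 + k) + 1], valid for every integer [k] *)
have ND : dotv v v <= (2 + g%:R) * D.
  apply: (@le_trans _ _ (2 * D + g%:R)); last by rewrite [leRHS]mulrDl lerD2l ler_peMr.
  rewrite DE [g%:R](_ : _ = (\sum_(i < g) (1 : int))%:~R); last first.
    by rewrite sumr_const card_ord natz -pmulrn.
  rewrite -[2]/(2%:~R) -intrM -intrD mulr_sumr -big_split rmorph_sum /=.
  apply: ler_sum => i _; rewrite !mxE -intrM ler_int; nia.
have := tau_nt_le c n t [ffun=> false]; rewrite tau_term0 => tau0.
have := hK m; rewrite -/v ler_norml => /andP[hm _].
have hKD : K * dotv v v <= K * ((2 + g%:R) * D) by rewrite ler_wpM2l.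
suff : K * (2 + g%:R) * D <= L%:R / 2 * D by lra.
rewrite ler_wpM2r //; first lra.
suff : 2 * (K * (2 + g%:R)) <= M%:R by move: ML; rewrite -(ler_nat R); lra.
near: M; exact: nbhs_infty_ger.
Unshelve. all: by end_near.
Qed.

Definition sum_len : R := \sum_(i < g) (len i)%:R.

Lemma dotv_mu_omega : dotv (mu R S) (omega R S) = - sum_len.
Proof. by rewrite /sum_len -sumrN; apply: eq_bigr => i _; rewrite !mxE mul1r. Qed.

Lemma dotv_phase v c n t : dotv v (phase c n t) =
  n%:~R * dotv v (mu R S) + t%:~R * dotv v (omega R S) + dotv v c.
Proof. by rewrite !dotvDr !dotvZr. Qed.

(** The row sums of [2 * minn (len i) (len j)] are the [2 * A_i]. *)
Lemma Bmx_mu L : Bmx R S L *m mu R S = L%:R *: mu R S.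
Proof.
apply/colP => i; rewrite !mxE; under eq_bigr do rewrite !mxE mulr1.
rewrite big_split /= -big_mkcond /= (big_pred1 i) => [|j]; last exact: eq_sym.
rewrite -mulr_sumr.
rewrite (_ : \sum_j _ = (A_ S (len i))%:R) ?subrK ?mulr1 //.
rewrite /A_ (big_nth 0%N) big_mkord natr_sum; exact: eq_bigr.
Qed.

(** The shift by a whole period is the translation of the phase by
    [Bmx *m mu].  The resulting correction is affine in the phase, and between
    the times [t] and [t + 1] it changes by [dotv mu omega], which is minus the
    total length of the solitons. *)
Lemma theta_nt_period c n t : \forall M \near \oo, forall L, (M <= L)%N ->
  [/\ theta_nt L c n t = tau_nt c n t,
      theta_nt L c n (t + 1) = tau_nt c n (t + 1)
    & theta_nt L c (n + L%:Z) (t + 1) - theta_nt L c (n + L%:Z) t =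
      tau_nt c n (t + 1) - tau_nt c n t + sum_len].
Proof.
have intv_mu : intv R (const_mx 1) = mu R S by apply/colP => i; rewrite !mxE.
have phaseL L s : (L%:R / 2) *: const_mx 1 + phase c (n + L%:Z) s =
    (L%:R / 2) *: const_mx 1 + phase c n s + Bmx R S L *m intv R (const_mx 1).
  by rewrite intv_mu Bmx_mu /phase intrD; apply/colP => i; rewrite !mxE; ring.
near=> M => L ML.
have h0 : is_theta_min (Bmx R S L) ((L%:R / 2) *: const_mx 1 + phase c n t) (tau_nt c n t).
  by move: L ML; near: M; exact: is_theta_min_tau.
have h1 : is_theta_min (Bmx R S L) ((L%:R / 2) *: const_mx 1 + phase c n (t + 1))
    (tau_nt c n (t + 1)) by move: L ML {h0}; near: M; exact: is_theta_min_tau.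
have k0 := is_theta_minD (const_mx 1) (Bmx_sym L) h0.
have k1 := is_theta_minD (const_mx 1) (Bmx_sym L) h1.
rewrite -phaseL in k0; rewrite -phaseL in k1.
rewrite /theta_nt !(trop_thetaE h0, trop_thetaE h1, trop_thetaE k0, trop_thetaE k1).
split=> //; rewrite intv_mu !(dotvDr _ (_ *: const_mx 1)) !dotv_phase intrD.
rewrite dotv_mu_omega; lra.
Unshelve. all: by end_near.
Qed.

Lemma tau_termE c n t r : tau_term c n t r =
  tau_term c 0 t r - n%:~R * dotv (chi r) (mu R S).
Proof. rewrite /tau_term !dotv_phase rmorph0; lra. Qed.

Lemma tau_term_bound c t : exists C : nat,
  forall r, `|tau_term c 0 t r| <= C%:R.
Proof.
pose C0 := \sum_r `|tau_term c 0 t r|.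
exists (Num.truncn C0).+1 => r.
apply: (@le_trans _ _ C0); last by rewrite ltW // truncnS_gt.
by rewrite /C0 (bigD1 r) //= lerDl sumr_ge0.
Qed.

Lemma dotv_chi_mu r : dotv (chi r) (mu R S) = (\sum_i (r i : nat))%N%:R.
Proof. by rewrite natr_sum; apply: eq_bigr => i _; rewrite !mxE mulr1. Qed.

(** For [n] far to the left every nonzero [r] has a large positive term; for
    [n] far to the right the slope in [n] selects the largest [r]. *)
Lemma tau_nt_left c t : exists N : nat,
  forall n : int, n <= - N%:Z -> tau_nt c n t = 0.
Proof.
have [C hC] := tau_term_bound c t; exists C => n nC.
rewrite -(tau_term0 c n t); apply: tau_nt_eq => r; rewrite tau_term0 tau_termE dotv_chi_mu.
have := hC r; rewrite ler_norml => /andP[h _].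
have [s0|s0] := posnP (\sum_i (r i : nat))%N.
  have -> : r = [ffun=> false].
    apply/ffunP => i; rewrite ffunE; apply/negbTE.
    by move/eqP: s0; rewrite sum_nat_eq0 => /forallP/(_ i)/=; case: (r i).
  by rewrite tau_term0 big1 ?mulr0 ?subrr // => i _; rewrite ffunE.
set k : R := (\sum_i _)%:R; have k1 : 1 <= k by rewrite ler1n.
have nC' : n%:~R <= - C%:R :> R by rewrite -(ler_int R) rmorphN in nC.
have C0 : 0 <= C%:R :> R by [].
have k0 : 0 <= k by apply: le_trans k1.
have := ler_wpM2r k0 nC'; have := ler_wpM2l C0 k1; lra.
Qed.

Lemma tau_nt_right c t : exists N : nat, forall n : int, N%:Z <= n ->
  tau_nt c n t = tau_term c n t [ffun=> true].
Proof.
have [C hC] := tau_term_bound c t; exists (2 * C)%N => n nC.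
apply: tau_nt_eq => r; rewrite !(tau_termE c n) !dotv_chi_mu.
rewrite (_ : (\sum_i ([ffun=> true] : {ffun 'I_g -> bool}) i = g)%N); last first.
  by under eq_bigr do rewrite ffunE; rewrite sum1_card card_ord.
have := hC r; rewrite ler_norml => /andP[hr _].
have := hC [ffun=> true]; rewrite ler_norml => /andP[_ h1].
have sle : (\sum_i (r i : nat) <= g)%N.
  by rewrite -[leqRHS]card_ord -sum1_card; apply: leq_sum => i _; case: (r i).
move: sle; rewrite leq_eqVlt => /predU1P[sE|slt].
  have -> : r = [ffun=> true].
    apply/ffunP => i; rewrite ffunE; case: (boolP (r i)) => // ri.
    suff : (\sum_i (r i : nat) < g)%N by rewrite sE ltnn.
    rewrite -[ltnRHS]card_ord -sum1_card (bigD1 i) //= [ltnRHS](bigD1 i) //=.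
    rewrite (negPf ri) add0n add1n ltnS; apply: leq_sum => j _; by case: (r j).
  by under [X in _ <= _ - _ * X%:R]eq_bigr do rewrite ffunE;
     rewrite sum1_card card_ord.
set k : R := (\sum_i _)%:R; have kg : 1 <= g%:R - k.
  by rewrite lerBrDl natr1 ler_nat.
have nC' : 2 * C%:R <= n%:~R :> R by rewrite -natrM -(ler_int R) in nC *.
have n0 : 0 <= n%:~R :> R by apply: le_trans nC'.
have := ler_wpM2l n0 kg; lra.
Qed.

Lemma tau_term1S c n t : tau_term c n (t + 1) [ffun=> true] =
  tau_term c n t [ffun=> true] + sum_len.
Proof.
rewrite /tau_term (_ : chi _ = mu R S); last by apply/colP => i; rewrite !mxE ffunE.
rewrite !dotv_phase intrD dotv_mu_omega; lra.
Qed.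

End ThetaLimit.

(** * The limit automaton *)

Section Limit.
Variables (R : realType) (S : seq nat) (c : 'cV[R]_(size S)).

(** The number of balls to the left of box [n] at time [t]. *)
Definition tau_mass (t n : int) : R := tau_nt c n (t + 1) - tau_nt c n t.

Definition tau_state (n t : int) : R := tau_mass t (n + 1) - tau_mass t n.

Lemma mixed_difference (a b a' b' : R) : a + b' - b - a' = b' - a' - (b - a).
Proof. by ring. Qed.

Lemma tau_mass_left t : exists N : nat,
  forall n : int, n <= - N%:Z -> tau_mass t n = 0.
Proof.
have [N hN] := tau_nt_left c t; have [N' hN'] := tau_nt_left c (t + 1).
exists (N + N')%N => n nN; rewrite /tau_mass hN ?hN' ?subrr //; lia.
Qed.

Lemma tau_mass_right t : exists N : nat,
  forall n : int, N%:Z <= n -> tau_mass t n = sum_len R S.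
Proof.
have [N hN] := tau_nt_right c t; have [N' hN'] := tau_nt_right c (t + 1).
exists (N + N')%N => n nN; rewrite /tau_mass hN ?hN' ?tau_term1S; [|lia..].
by rewrite addrC addKr.
Qed.

Lemma series_tau_state n t :
  series (fun j => tau_state (n - 1 - j%:Z) t) @ \oo --> tau_mass t n.
Proof.
have [N hN] := tau_mass_left t.
apply: cvg_near_cst; near=> k.
rewrite /series /= (telescope_sumr_eq (fun j : nat => - tau_mass t (n - j%:Z))) //.
  rewrite subr0 hN ?oppr0 ?sub0r ?opprK //.
  suff : (N + `|n|%N <= k)%N by lia.
  by near: k; exact: nbhs_infty_ge.
move=> j _; rewrite /tau_state opprK addrC; congr (- _ + _); congr tau_mass; lia.
Unshelve. all: by end_near.
Qed.

Variables (m0 : nat) (U : nat -> int -> int -> bool).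
Hypothesis Utheta : \forall M \near \oo, forall n t,
     let Th := theta_nt (m0 + M) c in
     (U M n t)%:R
     = Th n t + Th (n + 1) (t + 1) - Th n (t + 1) - Th (n + 1) t.

Lemma near_tau_state n t : \forall M \near \oo, (U M n t)%:R = tau_state n t.
Proof.
apply: filterS3 Utheta (theta_nt_period c n t) (theta_nt_period c (n + 1) t).
move=> M UM near_n near_n1; have LM : (M <= m0 + M)%N := leq_addl _ _.
have [e00 e01 _] := near_n _ LM; have [e10 e11 _] := near_n1 _ LM.
by rewrite UM /= e00 e01 e10 e11; exact: mixed_difference.
Qed.

(** The theta function expression telescopes over a period, and the two ends
    differ by the quasi-periodicity. *)
Lemma near_mass t : \forall M \near \oo,
  \sum_(i < m0 + M) (U M i%:Z t)%:R = sum_len R S.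
Proof.
apply: filterS2 Utheta (theta_nt_period c 0 t) => M UM near0; set L := (m0 + M)%N.
have [h0 h1] := near0 L (leq_addl _ _); rewrite add0r => hL.
pose G (i : nat) := theta_nt L c i%:Z (t + 1) - theta_nt L c i%:Z t.
have UG (i : nat) : (U M i%:Z t)%:R = G i.+1 - G i.
  have iS : i%:Z + 1 = i.+1%:Z by lia.
  by rewrite /G -iS; exact: etrans (UM _ _) (mixed_difference _ _ _ _).
rewrite (_ : \sum_i _ = G L - G 0%N).
  by rewrite [G L]hL /G h0 h1 addrC addKr.
rewrite -(telescope_sumr G (leq0n L)) big_mkord.
by apply: eq_bigr => i _; exact: UG.
Qed.

Hypothesis Upbbs : \forall M \near \oo, pbbs_solution (m0 + M) (U M).

(** The rule of the automaton at box [n] follows from that of the periodic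
    automaton of a large period, through its carrier.  Its load at [n] is found
    by going left from box [n + k], beyond which [tau_state] vanishes at both
    times: that box is empty before and after the step, so the carrier is empty
    there, and the changes of the load in between are read off [tau_state].
    Finitely many boxes are involved, which are all correct for large [M]. *)
Lemma tau_state_bbs n t : tau_state n (t + 1) =
  Num.min (1 - tau_state n t) (tau_mass t n - tau_mass (t + 1) n).
Proof.
have [N0 hN0] := tau_mass_right t; have [N1 hN1] := tau_mass_right (t + 1).
pose k := (N0 + N1 + `|n|)%N.
have UE s : \forall M \near \oo, forall i : 'I_k.+1,
    (U M (n + i%:Z) s)%:R = tau_state (n + i%:Z) s.
  by apply: filter_forall => i; exact: near_tau_state.
near \oo => M.
have /(_ t)[[uL _] step] : pbbs_solution (m0 + M) (U M) by near: M.
have M0 : (0 < M)%N by near: M; exact: nbhs_infty_gt.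
have L0 : (0 < m0 + M)%N by rewrite addn_gt0 M0 orbT.
have u_tau : forall i : 'I_k.+1, (U M (n + i%:Z) t)%:R = tau_state (n + i%:Z) t.
  by near: M; exact: UE.
have v_tau : forall i : 'I_k.+1,
    (U M (n + i%:Z) (t + 1))%:R = tau_state (n + i%:Z) (t + 1).
  by near: M; exact: UE.
have massu : \sum_(i < m0 + M) (U M i%:Z t)%:R = sum_len R S.
  by near: M; exact: near_mass.
have massv : \sum_(i < m0 + M) (U M i%:Z (t + 1))%:R = sum_len R S.
  by near: M; exact: near_mass.
have mass : (\sum_(i < m0 + M) pbbs_step (m0 + M) (U M ^~ t) i%:Z =
    \sum_(i < m0 + M) U M i%:Z t)%N.
  by apply/eqP; rewrite -(eqr_nat R) !natr_sum -step massu massv.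
have [E hE] := pbbs_carrier L0 uL mass; rewrite -step in hE.
have E_tau j : (j <= k)%N -> (E (n + (k - j)%N%:Z))%:R =
    tau_mass t (n + (k - j)%N%:Z) - tau_mass (t + 1) (n + (k - j)%N%:Z) :> R.
  elim: j => [_|j IH jk].
    have mass_right s (m : int) : n + k%:Z <= m ->
        (s = t) \/ (s = t + 1) -> tau_mass s m = sum_len R S.
      by move=> hm [->|->]; [apply: hN0|apply: hN1]; lia.
    have state0 s : (s = t) \/ (s = t + 1) -> tau_state (n + k%:Z) s = 0.
      by move=> hs; rewrite /tau_state !mass_right ?subrr //; lia.
    have ku : U M (n + k%:Z) t = false.
      have := u_tau ord_max; rewrite state0; last by left.
      by case: (U M _ t) => // /eqP; rewrite oner_eq0.
    have kv : U M (n + k%:Z) (t + 1) = false.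
      have := v_tau ord_max; rewrite state0; last by right.
      by case: (U M _ (t + 1)) => // /eqP; rewrite oner_eq0.
    have [_] := hE (n + k%:Z); rewrite ku kv subn0 /= => /esym/negbT.
    rewrite -eqn0Ngt => /eqP->; rewrite !mass_right ?subrr //; auto.
  have {}IH := IH (ltnW jk); set i := (k - j.+1)%N.
  have ik : (i < k.+1)%N by rewrite /i; lia.
  have ji : (k - j)%N%:Z = i%:Z + 1 by rewrite /i; lia.
  have := u_tau (Ordinal ik); have := v_tau (Ordinal ik); rewrite /= /tau_state.
  have [+ _] := hE (n + i%:Z) => /(congr1 (fun x : nat => x%:R : R)).
  rewrite !natrD -addrA -ji IH; lra.
have [_ vE] := hE n.
have En : (E n)%:R = tau_mass t n - tau_mass (t + 1) n.
  by have := E_tau k (leqnn k); rewrite subnn addr0.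
have := u_tau ord0; have := v_tau ord0; rewrite addr0 -En vE => <- <-.
case: (U M n t); rewrite /= ?subrr ?subr0.
  by rewrite min_l.
case: (posnP (E n)) => [->|E0]; first by rewrite min_r.
by rewrite min_l ?ler1n.
Unshelve. all: by end_near.
Qed.

End Limit.

Theorem theorem3p9 (R : realType) (w : seq bool) (S : seq nat)
    (lift : forall n, ('I_n -> R * R) -> 'I_n -> gpoint R S)
    (c : 'cV[R]_(size S)) (o : int) (U : nat -> int -> int -> bool) :
  true \in w ->
  word_solitons w S ->
  (\forall M \near \oo, is_vector_c w lift M c) ->
  (forall M, (1 <= M)%N -> (2 * count_mem true w < size w + M)%N ->
     pbbs_solution (size w + M) (U M) /\
     forall n, U M (o + n) 0 = word_state w (size w + M) n) ->
  (\forall M \near \oo, forall n t,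
     let Th := theta_nt (size w + M) c in
     (U M n t)%:R
     = Th n t + Th (n + 1) (t + 1) - Th n (t + 1) - Th (n + 1) t) ->
  exists Ut : int -> int -> R,
    [/\ forall n t, (U M n t)%:R @[M --> \oo] --> Ut n t,
        forall n t,
          Ut n t = tau_nt c n t + tau_nt c (n + 1) (t + 1)
                   - tau_nt c (n + 1) t - tau_nt c n (t + 1)
      & forall n t,
          [/\ cvgn (series (fun j => Ut (n - 1 - j%:Z) t)),
              cvgn (series (fun j => Ut (n - 1 - j%:Z) (t + 1)))
            & Ut n (t + 1) =
              Num.min (1 - Ut n t)
                (limn (series (fun j => Ut (n - 1 - j%:Z) t))
                 - limn (series (fun j => Ut (n - 1 - j%:Z) (t + 1))))]].
Proof.
move=> _ _ _ Usol Utheta; exists (tau_state c).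
have Upbbs : \forall M \near \oo, pbbs_solution (size w + M) (U M).
  near=> M; have [//||] := Usol M; last by [].
    by near: M; exact: nbhs_infty_ge.
  suff : (2 * count_mem true w < M)%N by lia.
  by near: M; exact: nbhs_infty_gt.
split=> [n t|n t|n t].
- by apply: cvg_near_cst; exact: near_tau_state Utheta n t.
- by rewrite /tau_state /tau_mass -mixed_difference addrAC.
split; [by apply/cvg_ex; exists (tau_mass c t n); exact: series_tau_state
       |by apply/cvg_ex; exists (tau_mass c (t + 1) n); exact: series_tau_state|].
rewrite (tau_state_bbs Utheta Upbbs).
by rewrite !(cvg_lim _ (@series_tau_state _ _ _ _ _)).
Unshelve. all: by end_near.
Qed.
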